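(* Let $P$ be a probability distribution on $\mathbb{R}^d$ which has bounded support and is absolutely continuous with respect to Lebesgue measure, and let $X_1,X_2,\ldots$ be i.i.d. with distribution $P$. Then for every $K\in\mathbb{N}$ there exists $\varepsilon>0$ such that if the within-cluster covariance matrix $\Sigma$ of the model satisfies $\|\Sigma\|<\varepsilon$, then almost surely the MAP partitions $\hat{\mathcal J}_n=\hat{\mathcal J}(X_1,\ldots,X_n)$ satisfy $|\hat{\mathcal J}_n|>K$ for all sufficiently large $n$.
   Context: Fix $d\ge 1$, $\alpha>0$ and a symmetric positive definite matrix $T\in\mathbb{R}^{d\times d}$; $\Sigma\in\mathbb{R}^{d\times d}$ is symmetric positive definite and $\|\Sigma\|$ is its operator norm. Put $C=\alpha/\sqrt{\det T}$, $R=\Sigma^{-1/2}$ and $R_m=(\Sigma^{-1}+T^{-1}/m)^{1/2}$ for $m\in\mathbb{N}$ (symmetric positive definite square roots); for vectors $\|\cdot\|$ is the Euclidean norm, and $[n]=\{1,\ldots,n\}$. For $\mathbf{x}=(x_1,\ldots,x_n)\in(\mathbb{R}^d)^n$, nonempty $J\subseteq[n]$, let $\overline{\mathbf{x}_J}=\frac1{|J|}\sum_{j\in J}x_j$. For a partition $\mathcal J$ of $[n]$ into nonempty sets (clusters) let $$Q_{\mathbf{x}}(\mathcal J)=C^{|\mathcal J|}\prod_{J\in\mathcal J}\frac{|J|!}{|J|^{(d+2)/2}\det R_{|J|}}\cdot\exp\Big\{\frac12\sum_{J\in\mathcal J}|J|\cdot\big\|R_{|J|}^{-1}R^2\,\overline{\mathbf{x}_J}\big\|^2\Big\}.$$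 Up to a factor not depending on $\mathcal J$, this is the posterior probability of $\mathcal J$ given $\mathbf{x}$ in the Gaussian mixture model in which $\mathcal J$ follows the Chinese Restaurant Process with parameter $\alpha$, cluster means are i.i.d. $\mathcal N(0,T)$, and given its cluster mean $\theta$ each observation of a cluster is independently $\mathcal N(\theta,\Sigma)$. A MAP (maximal a posteriori) partition $\hat{\mathcal J}(x_1,\ldots,x_n)$ is any partition of $[n]$ maximising $Q_{\mathbf{x}}$. *)

(* Defs.v *)
From HB Require Import structures.
From mathcomp Require Import all_boot all_order all_algebra.
From mathcomp Require Import all_classical all_reals all_analysis.

Set Implicit Arguments.
Unset Strict Implicit.
Unset Printing Implicit Defensive.

Import Order.TTheory GRing.Theory Num.Theory.
Import numFieldNormedType.Exports.

Local Open Scope classical_set_scope.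
Local Open Scope ring_scope.

Definition borel_cV (R : realType) (d : nat) :=
  g_sigma_algebraType (@open 'cV[R]_d).

Section Lebesgue.
Variable R : realType.

Lemma measurable_cV_coord d (i : 'I_d) (j : 'I_1) :
  @measurable_fun _ _ (borel_cV R d) (measurableTypeR R) setT (fun v => v i j).
Proof.
apply: (@measurability _ _ _ _ _ _ (@measurable_realfun.RGenOInfty.G R)).
  exact: measurable_realfun.RGenOInfty.measurableE.
move=> _ [_ [a ->] <-].
rewrite setTI; apply: sub_sigma_algebra.
have /continuousP := @coord_continuous R d 1 i j; apply.
exact: interval_open.
Qed.

Lemma measurable_to_cV dT (T : measurableType dT) d (f : T -> borel_cV R d) :
  (forall i,
    @measurable_fun _ _ T (measurableTypeR R) setT (fun t => f t i 0)) ->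
  measurable_fun setT f.
Proof.
move=> mf; apply: (@measurability _ _ T (borel_cV R d) _ _ (@open 'cV[R]_d)) => //.
move=> _ [U oU <-]; rewrite setTI.
pose box (q : 'cV[rat]_d * 'cV[rat]_d) : set 'cV[R]_d :=
  [set v | forall i, ratr (q.1 i 0) < v i 0 < ratr (q.2 i 0)].
have UE : U = \bigcup_(q : 'cV[rat]_d * 'cV[rat]_d)
    (if `[< box q `<=` U >] then box q else set0).
  apply/seteqP; split => [v Uv|v [q _]]; last first.
    by case: asboolP => // qU /qU.
  have /nbhs_ballP[e /= e0 eU] : nbhs v U by exact: open_nbhs_nbhs.
  have lo i : exists q : rat, v i 0 - e < ratr q < v i 0.
    have [|q] := @rat_in_itvoo R (v i 0 - e) (v i 0); first by rewrite ltrBlDr ltrDl.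
    by rewrite in_itv /= => ?; exists q.
  have hi i : exists q : rat, v i 0 < ratr q < v i 0 + e.
    have [|q] := @rat_in_itvoo R (v i 0) (v i 0 + e); first by rewrite ltrDl.
    by rewrite in_itv /= => ?; exists q.
  have /choice[a aP] := lo; have /choice[b bP] := hi.
  exists (\col_i a i, \col_i b i) => //.
  case: asboolP => [_ i|[]] /=.
    by rewrite !mxE; case/andP: (aP i) (bP i) => _ -> /andP[->].
  move=> w /= bw; apply: eU; split => // i j; rewrite (ord1 j).
  have := bw i; rewrite !mxE /= => /andP[aw wb].
  have /andP[va _] := aP i; have /andP[_ bv] := bP i.
  rewrite /ball /= ltr_norml; apply/andP; split.
    by rewrite ltrBrDl -ltrBrDr opprK; exact: lt_trans wb bv.
  by rewrite ltrBlDl -ltrBlDr; exact: lt_trans va aw.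
rewrite UE preimage_bigcup; apply: countable_bigcupT_measurable => // q.
case: asboolP => // _; last by rewrite preimage_set0.
have -> : f @^-1` box q = \bigcap_(i in [set: 'I_d])
    ((fun t => f t i 0 : measurableTypeR R) @^-1`
      `]ratr (q.1 i 0), ratr (q.2 i 0)[%classic).
  apply/seteqP; split => t /=.
    by move=> h i _ /=; rewrite in_itv; exact: h.
  by move=> h i; have := h i I; rewrite /= in_itv.
apply: fin_bigcap_measurable => // i _.
by rewrite -[X in measurable X]setTI; apply: mf => //; exact: measurable_itv.
Qed.

Definition cons_cV d (p : measurableTypeR R * borel_cV R d) : borel_cV R d.+1 :=
  col_mx (p.1%:M : 'M[R]_1) p.2.

Definition uncons_cV d (v : borel_cV R d.+1) : measurableTypeR R * borel_cV R d :=
  (v 0 0, dsubmx (v : 'M[R]_(1 + d, 1))).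

Lemma cons_cVK d : cancel (@cons_cV d) (@uncons_cV d).
Proof.
move=> [x v]; rewrite /cons_cV /uncons_cV /=; congr pair; last exact: col_mxKd.
have -> : (0 : 'I_d.+1) = lshift d (0 : 'I_1) by exact/val_inj.
by rewrite (@col_mxEu _ 1 d 1) mxE eqxx.
Qed.

Lemma measurable_cons_cV d : measurable_fun setT (@cons_cV d).
Proof.
apply: measurable_to_cV => i.
case: (@splitP 1 d i) => [k ik|k ik].
  have -> : i = lshift d k by exact/val_inj.
  apply: (eq_measurable_fun fst) => [[x v] _|]; last exact: measurable_fst.
  by rewrite /cons_cV (@col_mxEu _ 1 d 1) mxE (ord1 k) eqxx.
have -> : i = rshift 1 k by exact/val_inj.
apply: (eq_measurable_fun ((fun v : borel_cV R d => v k 0) \o snd)).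
  by move=> [x v] _; rewrite /cons_cV (@col_mxEd _ 1 d 1).
by apply: measurableT_comp; [exact: measurable_cV_coord|exact: measurable_snd].
Qed.

Lemma measurable_uncons_cV d : measurable_fun setT (@uncons_cV d).
Proof.
apply: measurable_fun_pair; first exact: measurable_cV_coord.
apply: measurable_to_cV => i.
apply: (eq_measurable_fun
  (fun v : borel_cV R d.+1 => v (rshift 1 i) 0 : measurableTypeR R)).
  by move=> v _; rewrite mxE.
exact: measurable_cV_coord.
Qed.

HB.instance Definition _ d :=
  isMeasurableFun.Build _ _ _ _ (@cons_cV d) (@measurable_cons_cV d).

Section step.
Variables (d : nat) (mu : {sigma_finite_measure set (borel_cV R d) -> \bar R}).

Definition lebesgue_cons : set (borel_cV R d.+1) -> \bar R :=
  pushforward (@lebesgue_measure R \x mu)%E (@cons_cV d).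

Let lebesgue_cons0 : lebesgue_cons set0 = 0%E.
Proof. by rewrite /lebesgue_cons; exact: measure0. Qed.

Let lebesgue_cons_ge0 A : (0 <= lebesgue_cons A)%E.
Proof. by rewrite /lebesgue_cons; exact: measure_ge0. Qed.

Let lebesgue_cons_sigma_additive : semi_sigma_additive lebesgue_cons.
Proof. by rewrite /lebesgue_cons; exact: measure_semi_sigma_additive. Qed.

HB.instance Definition _ := isMeasure.Build _ _ _ lebesgue_cons
  lebesgue_cons0 lebesgue_cons_ge0 lebesgue_cons_sigma_additive.

Let lebesgue_cons_sigma_finite : sigma_finite setT lebesgue_cons.
Proof.
have /sigma_finiteP[F [TF ndF Foo]] := sigma_finiteT (@lebesgue_measure R).
have /sigma_finiteP[G [TG ndG Goo]] := sigma_finiteT mu.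
exists (fun n => @uncons_cV d @^-1` (F n `*` G n)).
  rewrite -preimage_bigcup -(@preimage_setT _ _ (@uncons_cV d)); congr (_ @^-1` _).
  rewrite -setXTT TF TG predeqE => -[x y]; split.
    move=> [/= [n _ Fnx] [k _ Gky]]; exists (maxn n k) => //; split.
    - by move: x Fnx; exact/subsetPset/ndF/leq_maxl.
    - by move: y Gky; exact/subsetPset/ndG/leq_maxr.
  by move=> [n _ []/= ? ?]; split; exists n.
move=> n; have [mF Fn] := Foo n; have [mG Gn] := Goo n; split.
  rewrite -[X in measurable X]setTI; apply: measurable_uncons_cV => //.
  exact: measurableX.
rewrite /lebesgue_cons /pushforward -comp_preimage.
have -> : @uncons_cV d \o @cons_cV d = id by apply/funext => p; exact: cons_cVK.
rewrite [X in (X < _)%E](product_measure1E _ _ mF mG).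
by rewrite lte_mul_pinfty// ge0_fin_numE.
Qed.

HB.instance Definition _ := @Measure_isSigmaFinite.Build _ _ _
  lebesgue_cons lebesgue_cons_sigma_finite.
End step.

(* Iterated product of one-dimensional Lebesgue measures, transported along
   R x R^d -> R^(d+1); characterized by lebesgue_cV_box below. *)
Fixpoint lebesgue_cV d : {sigma_finite_measure set (borel_cV R d) -> \bar R} :=
  match d with
  | 0 => \d_(0 : borel_cV R 0)
  | d'.+1 => lebesgue_cons (lebesgue_cV d')
  end.

Lemma lebesgue_cV_box d (A : 'I_d -> set (measurableTypeR R)) :
  (forall i, measurable (A i)) ->
  lebesgue_cV d [set v | forall i, A i (v i 0)] =
    (\prod_(i < d) lebesgue_measure (A i))%E.
Proof.
elim: d A => [A _|d IH A mA].
  by rewrite big_ord0 /= diracE mem_set //= => -[].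
rewrite big_ord_recl -IH//.
have -> : lebesgue_cV d.+1 [set v | forall i, A i (v i 0)] =
    (lebesgue_measure \x lebesgue_cV d)%E
      (A ord0 `*` [set v : borel_cV R d | forall i, A (lift ord0 i) (v i 0)]).
  rewrite [LHS]/= /lebesgue_cons /pushforward; congr (_ _).
  apply/seteqP; split => [[x v]/= h|[x v]/= [h0 h] i].
    have E0 : (0 : 'I_d.+1) = lshift d (0 : 'I_1) by exact/val_inj.
    split=> [|i].
      by move: (h 0); rewrite {2}E0 /cons_cV (@col_mxEu _ 1 d 1) mxE eqxx.
    have := h (rshift 1 i); rewrite /cons_cV (@col_mxEd _ 1 d 1).
    by have <- : lift ord0 i = rshift 1 i by exact/val_inj.
  case: (@splitP 1 d i) => [k ik|k ik].
    have -> : i = lshift d k by exact/val_inj.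
    rewrite /cons_cV (@col_mxEu _ 1 d 1) mxE (ord1 k) eqxx.
    by have <- : ord0 = lshift d (0 : 'I_1) by exact/val_inj.
  have -> : i = rshift 1 k by exact/val_inj.
  rewrite /cons_cV (@col_mxEd _ 1 d 1).
  by have <- : lift ord0 k = rshift 1 k by exact/val_inj.
rewrite product_measure1E//.
have -> : [set v : borel_cV R d | forall i, A (lift ord0 i) (v i 0)] =
  \bigcap_(i in [set: 'I_d]) ((fun v : borel_cV R d => v i 0) @^-1` A (lift ord0 i)).
  by apply/seteqP; split => v /= h i; [move=> _; exact: h|exact: (h i I)].
apply: fin_bigcap_measurable => // i _.
by rewrite -[X in measurable X]setTI; apply: measurable_cV_coord.
Qed.

End Lebesgue.

Section Distributions.
Context {R : realType}.

(* Topological support. *)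
Definition msupport d (P : probability (borel_cV R d) R) : set 'cV[R]_d :=
  [set x | forall U : set 'cV[R]_d, open U -> U x -> (0 < P U)%E].

Definition mutually_independent dO (Omega : measurableType dO)
    dS (S : measurableType dS) (Pr : probability Omega R)
    (X : nat -> {RV Pr >-> S}) : Prop :=
  forall (I : seq nat) (A : nat -> set S), uniq I ->
    (forall i, i \in I -> measurable (A i)) ->
    Pr (\bigcap_(i in [set` I]) (X i @^-1` A i)) =
      (\prod_(i <- I) Pr (X i @^-1` A i))%E.

Definition iid dO (Omega : measurableType dO) dS (S : measurableType dS)
    (Pr : probability Omega R) (P : probability S R)
    (X : nat -> {RV Pr >-> S}) : Prop :=
  mutually_independent X /\
  (forall i A, measurable A -> distribution Pr (X i) A = P A).

End Distributions.

Section Model.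
Context {R : realType} {d : nat}.
Implicit Types (A B T Sigma : 'M[R]_d) (x : 'cV[R]_d).

Definition posdefmx A : Prop :=
  A^T = A /\ forall x, x != 0 -> 0 < (x^T *m A *m x) 0 0.

(* Every positive definite matrix has exactly one positive definite square root,
   so the default value 0 only matters for other arguments. *)
Definition posdef_sqrtmx A : 'M[R]_d :=
  xget 0 [set B | posdefmx B /\ B *m B = A].

(* `|x| is the sup norm on matrices, hence this separate Euclidean norm. *)
Definition enorm x : R := Num.sqrt (\sum_i x i 0 ^+ 2).

Definition opnorm A : R := sup [set enorm (A *m x) | x in [set x | enorm x <= 1]].

Definition clusterR T Sigma (m : nat) : 'M[R]_d :=
  posdef_sqrtmx (invmx Sigma + m%:R^-1 *: invmx T).

Definition cluster_mean n (x : 'I_n -> 'cV[R]_d) (J : {set 'I_n}) : 'cV[R]_d :=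
  #|J|%:R^-1 *: \sum_(j in J) x j.

(* Unnormalized posterior weight of the partition P. In the factor attached to a
   cluster J, Rm #|J| is the square root of Sigma^-1 + T^-1 / #|J|; the sample
   x_1, ..., x_n is indexed from 0. *)
Definition posteriorQ (alpha : R) T Sigma n (x : 'I_n -> 'cV[R]_d)
    (P : {set {set 'I_n}}) : R :=
  let C := alpha / Num.sqrt (\det T) in
  let R0 := posdef_sqrtmx (invmx Sigma) in
  let Rm := clusterR T Sigma in
  C ^+ #|P| *
  (\prod_(J in P)
     ((#|J|)`!%:R / (#|J|%:R `^ (d.+2%:R / 2) * \det (Rm #|J|)))) *
  expR (2^-1 * \sum_(J in P)
    #|J|%:R * enorm (invmx (Rm #|J|) *m (R0 *m R0) *m cluster_mean x J) ^+ 2).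

Definition is_MAP (alpha : R) T Sigma n (x : 'I_n -> 'cV[R]_d)
    (P : {set {set 'I_n}}) : Prop :=
  finset.partition P [set: 'I_n]%SET /\
  forall P' : {set {set 'I_n}}, finset.partition P' [set: 'I_n]%SET ->
    posteriorQ alpha T Sigma x P' <= posteriorQ alpha T Sigma x P.

End Model.

(* Main.v *)
Require Import Defs.
From mathcomp Require Import all_boot all_order all_algebra.
From mathcomp Require Import all_classical all_reals all_analysis.
From mathcomp Require Import sesquilinear spectral complex ring lra zify.

Set Implicit Arguments.
Unset Strict Implicit.
Unset Printing Implicit Defensive.

Import Order.TTheory GRing.Theory Num.Theory.
Import numFieldNormedType.Exports.

Local Open Scope classical_set_scope.
Local Open Scope ring_scope.

(** The proof compares a partition with at most [K] clusters to the one
    obtained by cutting a single cluster [J] in two, and shows that for a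
    large sample some such cut strictly increases the posterior weight.

    The weight is a product over the clusters ([posteriorQE]), so the cut
    replaces one factor by two. Cutting [m = m1 + m2] points costs at most a
    factor [2 ^ m] through the factorials (a binomial coefficient), a power
    of the sample size through the powers of [m], and a constant through the
    determinants, since [R_m ^+ 2] runs through a compact segment of
    positive definite matrices ([cluster_coef_split]). In the exponent,
    [R^2 R_m^-2 R^2 = A (A + B / m)^-1 A] with [A = Sigma^-1], [B = T^-1]
    differs from [A] by at most [B / m] ([parallel_sum_bounds]); on bounded
    data the exponent of a cluster is therefore [m x' A x / 2], [x] being
    its mean, up to an error independent of [m] and of [Sigma]. Cutting thus
    adds to the exponent at least half of [m1 (x1 - x)' A (x1 - x)], up to a
    constant, where [x1] is the mean of the first piece. By Cauchy-Schwarz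
    this is at least [m1 / |Sigma|] times the square of any one coordinate
    of [x1 - x] ([coord_sqr_le_bform_invmx]), so a small [Sigma] makes it
    exceed the cost as soon as [m1] is proportional to [n] and [x1 - x] is
    bounded away from 0 in one coordinate ([cluster_weight_split]).

    A cluster and a cut of this kind always exist. As hyperplanes are null
    sets for [P], its support contains [K + 1] points with distinct first
    coordinates ([msupport_coords]), say at least [4 h] apart. A cluster
    mean is within [2 h] of at most one of these coordinates, so at most [K]
    means leave one of them, [y], at distance [2 h] from all of them
    ([far_from_centers]). The slab [|v_0 - y| < h] has positive probability,
    hence almost surely receives a positive proportion of the sample
    ([positive_frequency]), and one of the at most [K] clusters contains a
    positive proportion [m1] of it. That cluster is cut along the slab
    ([MAP_many_clusters]): the mean of its part in the slab is within [h] of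
    [y], hence at distance at least [h] from the mean of the cluster. *)

(** * Square roots of positive definite matrices *)

Lemma trmx_horner_mx (R : comNzRingType) n (A : 'M[R]_n.+1) (p : {poly R}) :
  (horner_mx A p)^T = horner_mx A^T p.
Proof.
elim/poly_ind: p => [|p c IH]; first by rewrite !rmorph0 trmx0.
rewrite !rmorphD !rmorphM /= !horner_mx_X !horner_mx_C linearD /= tr_scalar_mx.
rewrite -[_ * A]/(_ *m A) trmx_mul IH; congr (_ + _).
exact: comm_mx_horner.
Qed.

(** A function of a symmetric real matrix, such as its square root, can be
    written as a polynomial in it, which keeps it real and symmetric. *)
Lemma poly_interpolation (F : fieldType) (f : F -> F) (s : seq F) :
  exists p : {poly F}, {in s, forall a, p.[a] = f a}.
Proof.
elim: s => [|b s [p pf]]; first by exists 0.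
have [bs|bs] := boolP (b \in s).
  by exists p => a; rewrite inE => /predU1P[->|]; exact: pf.
pose q := \prod_(a <- s) ('X - a%:P).
have qb : q.[b] != 0.
  by have := root_prod_XsubC s b; rewrite /root => ->.
exists (p + ((f b - p.[b]) / q.[b]) *: q) => a.
rewrite inE hornerD hornerZ => /predU1P[->|sa].
  by rewrite divfK// addrC subrK.
have /eqP -> : q.[a] == 0 by have := root_prod_XsubC s a; rewrite /root sa => ->.
by rewrite mulr0 addr0 pf.
Qed.

Section Spectral.
Local Open Scope sesquilinear_scope.
Variables (R : realType) (n : nat).
Implicit Types (A B : 'M[R]_n.+1) (x : 'cV[R]_n.+1).

Local Notation toC := (map_mx (real_complex R)).

(** The spectral theorem for normal matrices gives a unitary diagonalization over
    [R[i]].  The eigenvalues are real, so they are roots of the real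
    characteristic polynomial and have real eigenvectors: positivity on real
    vectors suffices to make them positive. *)
Lemma posdef_spectral A : posdefmx A ->
  exists (P : 'M[R[i]]_n.+1) (s : 'rV[R]_n.+1),
    [/\ P \is unitarymx, forall j, 0 < s 0 j &
        toC A = invmx P *m diag_mx (toC s) *m P].
Proof.
move=> [Asym Apos].
have Aherm : toC A \is hermsymmx.
  apply/is_hermitianmxP; rewrite expr0 scale1r; apply/matrixP => i j.
  rewrite !mxE -[in LHS]Asym mxE conj_Creal//.
  by apply/complex_realP; exists (A j i).
have /hermitian_normalmx/orthomx_spectralP A_eq := Aherm.
have /mxOverP sreal := hermitian_spectral_diag_real Aherm.
pose P := spectralmx (toC A); pose s := map_mx (@complex.Re R) (spectral_diag (toC A)).
have sE : toC s = spectral_diag (toC A).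
  by apply/rowP => j; rewrite !mxE RRe_real.
exists P, s; split; first exact: spectral_unitarymx.
- move=> j.
  have /eigenvalueP[v vA v0] : eigenvalue A (s 0 j).
    rewrite eigenvalue_root_char -(fmorph_root (real_complex R)) map_char_poly.
    rewrite -eigenvalue_root_char; apply/eigenvalueP.
    exists (row j P).
      rewrite {1}A_eq !mulmxA -row_mul mulmxV ?spectral_unit// row1 -rowE.
      by rewrite row_diag_mx -scalemxAl -rowE -sE mxE.
    apply/negP => /eqP Pj0.
    have : row j P *m invmx P = 0 by rewrite Pj0 mul0mx.
    rewrite -row_mul mulmxV ?spectral_unit// => /rowP/(_ j).
    by rewrite !mxE eqxx => /eqP; rewrite oner_eq0.
  have := Apos v^T; rewrite trmxK vA -scalemxAl mxE => /(_ _).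
  have -> : v^T != 0 by rewrite -(trmx0 R) (inj_eq trmx_inj).
  move=> /(_ isT); apply: contraTT; rewrite -!leNgt => sj0.
  rewrite mulr_le0_ge0// mxE sumr_ge0// => k _.
  by rewrite mxE -expr2 sqr_ge0.
- by rewrite sE.
Qed.

(** The root is [p(A)], where [p] interpolates the square root on the spectrum. *)
Lemma posdef_sqrt_exists A : posdefmx A -> exists B, posdefmx B /\ B *m B = A.
Proof.
move=> pA; have [P [s [Pu s0 AE]]] := posdef_spectral pA.
have PU : P \in unitmx := unitarymx_unit Pu.
have [p pE] := poly_interpolation (@Num.sqrt R) (codom (s 0)).
have ps j : p.[s 0 j] = Num.sqrt (s 0 j) by apply: pE; exact: codom_f.
pose B := horner_mx A p; pose r := map_mx (@Num.sqrt R) s.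
pose D := diag_mx (toC r).
have DD : D *m D = diag_mx (toC s).
  rewrite mulmx_diag; congr diag_mx; apply/rowP => j.
  by rewrite !mxE -rmorphM -expr2 sqr_sqrtr// ltW.
have rE : map_mx (horner (map_poly (real_complex R) p)) (toC s) = toC r.
  by apply/rowP => j; rewrite !mxE horner_map ps.
have BE : toC B = invmx P *m D *m P.
  rewrite map_horner_mx AE (horner_mx_uconjC _ _ PU) horner_mx_diag.
  by rewrite rE.
exists B; split; last first.
  apply: (map_mx_inj (f := real_complex R)); rewrite map_mxM BE AE -DD.
  move: (invmx P) (mulmxV PU) => Q PQ.
  by rewrite !mulmxA -(mulmxA _ P) PQ mulmx1.
split; first by rewrite /B trmx_horner_mx (proj1 pA).
move=> x x0; pose y := P *m toC x.
have y0 : y != 0.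
  apply: contra x0 => /eqP y0; apply/eqP/(map_mx_inj (f := real_complex R)).
  by rewrite -[toC x](mulKmx PU) -/y y0 mulmx0 map_mx0.
have xE : (toC x)^T *m invmx P = y ^t*.
  rewrite invmx_unitary// /y trmx_mul map_mxM; congr (_ *m _).
  apply/rowP => j; rewrite !mxE; apply/esym/conj_Creal.
  by apply/complex_realP; exists (x j 0).
rewrite -ltcR.
have -> : ((x^T *m B *m x) 0 0)%:C%C = (y ^t* *m D *m y) 0 0.
  transitivity (toC (x^T *m B *m x) 0 0); first by rewrite [RHS]mxE.
  by rewrite !map_mxM BE -map_trmx !mulmxA xE -(mulmxA _ P).
clear xE; clearbody y.
have [j yj] : exists j, y j 0 != 0.
  by apply/(cV0Pn y).
rewrite mxE (bigD1 j)//= ltr_wpDr//.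
  rewrite sumr_ge0// => k _; rewrite mul_mx_diag !mxE mulrAC -normCKC.
  by rewrite mulr_ge0 ?exprn_ge0// ler0c sqrtr_ge0.
rewrite mul_mx_diag !mxE mulrAC -normCKC mulr_gt0//.
  by rewrite exprn_gt0// normr_gt0.
by rewrite (ltcR 0) sqrtr_gt0.
Qed.

End Spectral.

(** * Quadratic forms *)

Section QuadraticForms.
Variables (R : realType) (d : nat).
Implicit Types (A B S : 'M[R]_d) (x y : 'cV[R]_d).

Definition bform A x y : R := (x^T *m A *m y) 0 0.

Lemma bformDr A x y z : bform A x (y + z) = bform A x y + bform A x z.
Proof. by rewrite /bform mulmxDr mxE. Qed.

Lemma bformZr A x c y : bform A x (c *: y) = c * bform A x y.
Proof. by rewrite /bform -scalemxAr mxE. Qed.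

Lemma bform0r A x : bform A x 0 = 0.
Proof. by rewrite /bform mulmx0 mxE. Qed.

Lemma bformDl A x y z : bform A (x + y) z = bform A x z + bform A y z.
Proof. by rewrite /bform linearD/= !mulmxDl mxE. Qed.

Lemma bformZl A x c y : bform A (c *: x) y = c * bform A x y.
Proof. by rewrite /bform linearZ/= -!scalemxAl mxE. Qed.

Lemma bformNr A x y : bform A x (- y) = - bform A x y.
Proof. by rewrite -scaleN1r bformZr mulN1r. Qed.

Lemma bformNl A x y : bform A (- x) y = - bform A x y.
Proof. by rewrite -scaleN1r bformZl mulN1r. Qed.

Lemma bform_sym A x y : A^T = A -> bform A x y = bform A y x.
Proof.
move=> As; rewrite /bform; transitivity ((x^T *m A *m y)^T 0 0).
  by rewrite [RHS]mxE.
by rewrite !trmx_mul trmxK As mulmxA.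
Qed.

Lemma bform_mulmx A B x y : bform A x (B *m y) = bform (A *m B) x y.
Proof. by rewrite /bform !mulmxA. Qed.

Lemma bform_ge0 A x : posdefmx A -> 0 <= bform A x x.
Proof.
move=> [_ Apos]; have [->|/Apos/ltW//] := eqVneq x 0.
by rewrite bform0r.
Qed.

Lemma posdef_unitmx A : posdefmx A -> A \in unitmx.
Proof.
move=> [_ Apos]; rewrite unitmxE unitfE; apply/det0P => -[v v0 vA].
have vT0 : v^T != 0 by rewrite -(trmx0 R) (inj_eq trmx_inj).
by have := Apos _ vT0; rewrite trmxK vA mul0mx mxE ltxx.
Qed.

Lemma posdef_invmx A : posdefmx A -> posdefmx (invmx A).
Proof.
move=> pA; have [As Apos] := pA; have Au := posdef_unitmx pA.
split; first by rewrite trmx_inv As.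
move=> x x0; have y0 : invmx A *m x != 0.
  by apply: contra x0 => /eqP Ax; rewrite -(mulKVmx Au x) Ax mulmx0.
have := Apos _ y0; rewrite trmx_mul trmx_inv As.
by rewrite -!mulmxA mulKVmx// mulmxA.
Qed.

Lemma posdefD A B (c : R) : posdefmx A -> posdefmx B -> 0 <= c ->
  posdefmx (A + c *: B).
Proof.
move=> [As Apos] pB c0; have [Bs _] := pB.
split; first by rewrite linearD/= linearZ/= As Bs.
move=> x x0; rewrite mulmxDr mulmxDl mxE ltr_wpDr ?Apos//.
by rewrite -scalemxAr -scalemxAl mxE mulr_ge0// bform_ge0.
Qed.

(** Positivity of the form at [(y' A y) x - (x' A y) y]. *)
Lemma bform_CauchySchwarz A x y : posdefmx A ->
  bform A x y ^+ 2 <= bform A x x * bform A y y.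
Proof.
move=> pA; have [As Apos] := pA.
have [->|y0] := eqVneq y 0.
  by rewrite !bform0r expr0n mulr0.
have yy : 0 < bform A y y by exact: Apos.
have := bform_ge0 (bform A y y *: x - bform A x y *: y) pA.
rewrite !(bformDl, bformDr, bformNl, bformNr, bformZl, bformZr).
rewrite (bform_sym y x As).
set a := bform A x x; set b := bform A x y; rewrite -/(bform A y y) in yy *.
set c := bform A y y in yy *.
rewrite [X in 0 <= X -> _](_ : _ = c * (a * c - b ^+ 2)); last by ring.
by rewrite pmulr_rge0// subr_ge0.
Qed.

(** The defect [A - A (A + B)^-1 A] is the parallel sum [(A^-1 + B^-1)^-1],
    which lies between [0] and [B].  With [z = (A + B)^-1 A x] and [w = x - z]
    one has [A w = B z], and both bounds become sums of values of the forms at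
    [w] and [z]. *)
Lemma parallel_sum_bounds A B x : posdefmx A -> posdefmx B ->
  bform A x x - bform B x x <= bform (A *m invmx (A + B) *m A) x x <= bform A x x.
Proof.
move=> pA pB; have [[As _] [Bs _]] := (pA, pB).
have Su : A + B \in unitmx.
  by apply: posdef_unitmx; rewrite -[B]scale1r; exact: posdefD.
pose z := invmx (A + B) *m A *m x; pose w := x - z.
have Azw : A *m w = B *m z.
  rewrite mulmxBr; apply/eqP; rewrite subr_eq addrC -mulmxDl /z.
  by rewrite -mulmxA mulKVmx.
have -> : bform (A *m invmx (A + B) *m A) x x = bform A x z.
  by rewrite /z bform_mulmx mulmxA.
have xE : x = w + z by rewrite subrK.
have cross : bform A z w = bform B z z.
  by rewrite /bform -!mulmxA Azw.
have cross2 : bform B w z = bform A w w.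
  by rewrite /bform -!mulmxA Azw.
have wA := bform_ge0 w pA; have zB := bform_ge0 z pB; have wB := bform_ge0 w pB.
have zw : bform A w z = bform B z z by rewrite bform_sym.
have zw2 : bform B z w = bform A w w by rewrite bform_sym.
clearbody w z.
rewrite xE !(bformDl, bformDr) cross cross2 zw zw2.
by apply/andP; split; lra.
Qed.

Lemma enorm_sqr x : enorm x ^+ 2 = (x^T *m x) 0 0.
Proof.
rewrite /enorm sqr_sqrtr; last by rewrite sumr_ge0// => i _; rewrite sqr_ge0.
by rewrite mxE; apply: eq_bigr => i _; rewrite mxE expr2.
Qed.

Lemma enorm_invmx_sqr B A x : posdefmx B -> A^T = A ->
  enorm (invmx B *m A *m x) ^+ 2 = bform (A *m invmx (B *m B) *m A) x x.
Proof.
move=> pB As; have Bu := posdef_unitmx pB; have [Bs _] := pB.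
rewrite enorm_sqr /bform !trmx_mul trmx_inv As Bs.
have -> : invmx (B *m B) = invmx B *m invmx B.
  have BBu : B *m B \in unitmx by rewrite unitmx_mul Bu.
  rewrite -[RHS](mulKmx BBu).
  by rewrite [B *m B *m _]mulmxA mulmxK// mulmxV// mulmx1.
by rewrite !mulmxA.
Qed.

Lemma enorm_ge_coord x i : `|x i 0| <= enorm x.
Proof.
rewrite -sqrtr_sqr ler_wsqrtr// (bigD1 i)//= lerDl sumr_ge0// => j _.
exact: sqr_ge0.
Qed.

(** The supremum defining [opnorm] is finite, so [A e_i] can be tested in it. *)
Lemma opnorm_ge_diag A i : A i i <= opnorm A.
Proof.
pose e : 'cV[R]_d := delta_mx i 0.
have enorm_e : enorm e = 1.
  rewrite /enorm (bigD1 i)//= big1 => [|j ji]; rewrite mxE ?eqxx ?(negbTE ji)//=.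
    by rewrite expr1n addr0 sqrtr1.
  by rewrite expr0n.
have Ae : A i i = (A *m e) i 0 by rewrite -colE mxE.
rewrite Ae (le_trans (ler_norm _))// (le_trans (enorm_ge_coord _ _))//.
apply: ub_le_sup; last by exists e => //=; rewrite enorm_e.
exists (Num.sqrt (\sum_k (\sum_j `|A k j|) ^+ 2)) => _ [x /= x1 <-].
rewrite ler_wsqrtr// ler_sum// => k _.
rewrite -[leLHS]real_normK ?num_real// ler_pXn2r ?nnegrE ?sumr_ge0// mxE.
rewrite (le_trans (ler_norm_sum _ _ _))// ler_sum// => j _.
by rewrite normrM ler_piMr// (le_trans (enorm_ge_coord _ _)).
Qed.

(** Cauchy-Schwarz for [A] at [e_i] and [A^-1 x], whose product is [x_i].  A
    covariance with a small entry [A i i] thus has an inverse that is large on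
    every vector whose coordinate [i] is not small. *)
Lemma coord_sqr_le_bform_invmx A x i : posdefmx A ->
  x i 0 ^+ 2 <= A i i * bform (invmx A) x x.
Proof.
move=> pA; have [As _] := pA; have Au := posdef_unitmx pA.
have := bform_CauchySchwarz (delta_mx i 0) (invmx A *m x) pA.
have rowi (v : 'cV[R]_d) : bform A (delta_mx i 0) v = (A *m v) i 0.
  by rewrite /bform trmx_delta -mulmxA -rowE mxE.
rewrite !rowi mulKVmx// -colE mxE.
by rewrite /bform trmx_mul trmx_inv As mulmxKV// mulmxA.
Qed.

Lemma bform_le_bounded A x (M : R) : (forall i, `|x i 0| <= M) ->
  bform A x x <= M ^+ 2 * \sum_i \sum_j `|A i j|.
Proof.
move=> xM; rewrite /bform mxE mulr_sumr.
under eq_bigr do rewrite mxE mulr_suml.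
rewrite exchange_big ler_sum//= => i _; rewrite mulr_sumr ler_sum// => j _.
rewrite (le_trans (ler_norm _))// !mxE !normrM mulrAC ler_wpM2r//.
by rewrite expr2 ler_pM.
Qed.

End QuadraticForms.

(** * The factors of the posterior weight *)

Section ClusterFactors.
Variables (R : realType) (d : nat).
Implicit Types (A B T Sigma : 'M[R]_d) (x : 'cV[R]_d).

Lemma posdef_sqrtmxP A : posdefmx A ->
  posdefmx (posdef_sqrtmx A) /\ posdef_sqrtmx A *m posdef_sqrtmx A = A.
Proof.
move=> pA; have [B BP] : exists B, posdefmx B /\ B *m B = A; last first.
  by apply: (@xgetPex _ 0 [set B | posdefmx B /\ B *m B = A]); exists B.
case: d A pA => [|n] A; last exact: posdef_sqrt_exists.
by exists A; split => //; rewrite !(flatmx0 A) mul0mx.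
Qed.

(** It is the square of the determinant of the square root. *)
Lemma posdef_det_gt0 A : posdefmx A -> 0 < \det A.
Proof.
move=> pA; have [_ <-] := posdef_sqrtmxP pA.
rewrite det_mulmx -expr2 exprn_even_gt0//=.
have [/posdef_unitmx] := posdef_sqrtmxP pA.
by rewrite unitmxE unitfE.
Qed.

(** The determinant is a polynomial in [t], positive on a compact interval. *)
Lemma det_pencil_bounds A B : posdefmx A -> posdefmx B ->
  exists a b : R, 0 < a /\ forall t, 0 <= t <= 1 -> a <= \det (A + t *: B) <= b.
Proof.
move=> pA pB.
pose q := \det (map_mx polyC A + 'X *: map_mx polyC B).
have qE t : q.[t] = \det (A + t *: B).
  rewrite -horner_evalE -det_map_mx; congr (\det _).
  by apply/matrixP => i j; rewrite !mxE /= horner_evalE !hornerE.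
have qc : {within `[0, 1], continuous (horner q)}.
  by apply: continuous_subspaceT => t; exact: continuous_horner.
have [u u01 qmin] := EVT_min ler01 qc; have [v _ qmax] := EVT_max ler01 qc.
exists q.[u], q.[v]; split.
  rewrite qE; apply: posdef_det_gt0; apply: posdefD => //.
  by move: u01; rewrite in_itv/= => /andP[].
by move=> t t01; rewrite -qE qmin ?qmax// in_itv.
Qed.

Lemma clusterR_spec T Sigma m : posdefmx T -> posdefmx Sigma ->
  posdefmx (clusterR T Sigma m) /\
  clusterR T Sigma m *m clusterR T Sigma m = invmx Sigma + m%:R^-1 *: invmx T.
Proof.
move=> pT pS; apply: posdef_sqrtmxP.
by apply: posdefD; rewrite ?invr_ge0//; exact: posdef_invmx.
Qed.

(** [R_m ^+ 2] is the value at [t = 1 / m], between 0 and 1, of a fixed pencil of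
    matrices. *)
Lemma det_clusterR_bounds T Sigma : posdefmx T -> posdefmx Sigma ->
  exists a b : R, 0 < a /\ forall m, a <= \det (clusterR T Sigma m) <= b.
Proof.
move=> pT pS.
have [a [b [a0 ab]]] := det_pencil_bounds (posdef_invmx pS) (posdef_invmx pT).
exists (Num.sqrt a), (Num.sqrt b); rewrite sqrtr_gt0; split => // m.
have [pR RR] := clusterR_spec m pT pS.
have R0 := posdef_det_gt0 pR.
have : a <= \det (invmx Sigma + m%:R^-1 *: invmx T) <= b.
  apply: ab; rewrite invr_ge0 ler0n; case: m {pR RR R0} => [|m].
    by rewrite invr0 ler01.
  by rewrite invf_le1 ?ler1n ?ltr0n.
rewrite -RR det_mulmx -expr2 => /andP[aR Rb].
by rewrite -(ger0_norm (ltW R0)) -sqrtr_sqr !ler_wsqrtr.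
Qed.

Definition cluster_exponent T Sigma (m : nat) x : R :=
  m%:R * enorm (invmx (clusterR T Sigma m) *m
    (posdef_sqrtmx (invmx Sigma) *m posdef_sqrtmx (invmx Sigma)) *m x) ^+ 2.

(** The error term depends neither on [m] nor on [Sigma]: the parallel sum of
    [Sigma^-1] and [T^-1 / m] is at most [T^-1 / m], and the factor [m] cancels. *)
Lemma cluster_exponent_bounds T Sigma m x : posdefmx T -> posdefmx Sigma ->
  (0 < m)%N ->
  m%:R * bform (invmx Sigma) x x - bform (invmx T) x x
    <= cluster_exponent T Sigma m x <= m%:R * bform (invmx Sigma) x x.
Proof.
move=> pT pS m0; rewrite /cluster_exponent.
have pA := posdef_invmx pS; have pB := posdef_invmx pT.
have [_ ->] := posdef_sqrtmxP pA; have [pR RR] := clusterR_spec m pT pS.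
rewrite (enorm_invmx_sqr _ pR (proj1 pA)) RR.
have mV0 : 0 < m%:R^-1 :> R by rewrite invr_gt0 ltr0n.
have pmB : posdefmx (m%:R^-1 *: invmx T).
  split; first by rewrite linearZ/= (proj1 pB).
  move=> y y0; rewrite -scalemxAr -scalemxAl mxE.
  by apply: mulr_gt0 => //; exact: (proj2 pB).
have := parallel_sum_bounds x pA pmB.
have -> : bform (m%:R^-1 *: invmx T) x x = m%:R^-1 * bform (invmx T) x x.
  by rewrite /bform -scalemxAr -scalemxAl mxE.
have m0' : 0 < m%:R :> R by rewrite ltr0n.
move=> /andP[lo hi]; rewrite ler_pM2l// hi andbT.
by rewrite -(ler_pM2l m0') mulrBr mulVKf ?gt_eqF in lo *.
Qed.

End ClusterFactors.

(** * The effect of cutting a cluster *)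

Lemma bin_le_exp2 n k : ('C(n, k) <= 2 ^ n)%N.
Proof.
elim: n k => [|n IH] [|k]; rewrite ?bin0 ?expn_gt0// ?bin0n//.
by rewrite binS expnS mul2n -addnn leq_add.
Qed.

Lemma fact_split_le m1 m2 : ((m1 + m2)`! <= 2 ^ (m1 + m2) * (m1`! * m2`!))%N.
Proof.
rewrite -(bin_fact (leq_addr m2 m1)) addKn leq_mul2r bin_le_exp2.
by rewrite orbT.
Qed.

(** By the single term of degree [k + 1] of the exponential series. *)
Lemma expR_beats_exprn (R : realType) (k : nat) (c : R) :
  exists N : nat, forall n, (N <= n)%N -> c * n%:R ^+ k < expR n%:R.
Proof.
pose F : R := k.+1`!%:R.
have F0 : 0 < F by rewrite ltr0n fact_gt0.
have [N cN] : exists N : nat, c * F < N%:R.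
  by exists (Num.truncn `|c * F|).+1; rewrite (le_lt_trans (ler_norm _))// truncnS_gt.
exists N => n Nn; apply: lt_le_trans (expR_ge1Dxn k (ler0n _ n)).
rewrite ltr_pwDl// ler_pdivlMr// mulrAC exprS ler_wpM2r ?exprn_ge0//.
by rewrite (le_trans (ltW cN))// ler_nat.
Qed.

Section SplitCluster.
Variables (R : realType) (d : nat) (alpha : R) (T Sigma : 'M[R]_d).
Hypotheses (alpha0 : 0 < alpha) (pT : posdefmx T) (pS : posdefmx Sigma).

Local Notation C := (alpha / Num.sqrt (\det T)).

Definition cluster_coef (m : nat) : R :=
  m`!%:R / (m%:R `^ (d.+2%:R / 2) * \det (clusterR T Sigma m)).

Definition cluster_weight (m : nat) (x : 'cV[R]_d) : R :=
  C * cluster_coef m * expR (2^-1 * cluster_exponent T Sigma m x).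

Lemma posteriorQE n (x : 'I_n -> 'cV[R]_d) (P : {set {set 'I_n}}) :
  posteriorQ alpha T Sigma x P =
  \prod_(J in P) cluster_weight #|J| (cluster_mean x J).
Proof.
rewrite /posteriorQ [RHS]big_split/= [X in _ = X * _]big_split/= prodr_const.
by rewrite mulr_sumr expR_sum.
Qed.

Lemma model_const_gt0 : 0 < C.
Proof. by rewrite divr_gt0// sqrtr_gt0 posdef_det_gt0. Qed.

Lemma cluster_coef_gt0 m : (0 < m)%N -> 0 < cluster_coef m.
Proof.
move=> m0; rewrite divr_gt0 ?ltr0n ?fact_gt0// mulr_gt0//.
  by rewrite powR_gt0// ltr0n.
by apply: posdef_det_gt0; have [] := clusterR_spec m pT pS.
Qed.

Lemma cluster_weight_gt0 m x : (0 < m)%N -> 0 < cluster_weight m x.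
Proof.
move=> m0; rewrite mulr_gt0 ?expR_gt0// mulr_gt0 ?model_const_gt0//.
exact: cluster_coef_gt0.
Qed.

(** The price of a cut: the binomial coefficient [m! / (m1! m2!)] is at most
    [2 ^ n], each power of a cluster size is at most [n ^ (d + 2)], and the
    determinants stay between positive constants. *)
Lemma cluster_coef_split : exists c : R, 0 < c /\
  forall n m1 m2, (0 < m1)%N -> (0 < m2)%N -> (m1 + m2 <= n)%N ->
  cluster_coef (m1 + m2) * c <=
    cluster_coef m1 * cluster_coef m2 * (2 ^+ n * n%:R ^+ (d.+2 + d.+2)).
Proof.
have [a [b [a0 ab]]] := det_clusterR_bounds pT pS.
have b0 : 0 < b by have /andP[aR Rb] := ab 0; exact: lt_le_trans a0 (le_trans aR Rb).
exists (a / b ^+ 2); split; first by rewrite divr_gt0// exprn_gt0.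
move=> n m1 m2 m10 m20 m12n; rewrite /cluster_coef.
set g : R := d.+2%:R / 2.
have g0 : 0 <= g by rewrite divr_ge0.
have pow_le m : (0 < m)%N -> (m <= n)%N -> m%:R `^ g <= n%:R ^+ d.+2.
  move=> m0 mn; apply: (@le_trans _ _ (m%:R `^ d.+2%:R)).
    rewrite ler_powR ?ler1n// /g ler_pdivrMr// ler_peMr// ler1n//.
  by rewrite powR_mulrn// lerXn2r ?nnegrE ?ler_nat.
have m1n : (m1 <= n)%N by rewrite (leq_trans _ m12n)// leq_addr.
have m2n : (m2 <= n)%N by rewrite (leq_trans _ m12n)// leq_addl.
have pow_ge1 m : (0 < m)%N -> 1 <= m%:R `^ g :> R.
  by move=> m0; rewrite -[leLHS](powRr0 m%:R) ler_powR ?ler1n.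
have m0 : (0 < m1 + m2)%N by rewrite addn_gt0 m10.
move: (pow_ge1 _ m10) (pow_ge1 _ m20) (pow_ge1 _ m0).
move: (pow_le _ m10 m1n) (pow_le _ m20 m2n).
set N := n%:R ^+ _; set p1 := _ `^ g; set p2 := _ `^ g => p1N p2N.
set p := _ `^ g => p11 p21 p_1.
move: (ab (m1 + m2)%N) (ab m1) (ab m2).
set D := \det _; set D1 := \det _; set D2 := \det _.
move=> /andP[aD Db] /andP[aD1 D1b] /andP[aD2 D2b].
have F_le : (m1 + m2)`!%:R <= 2 ^+ n * (m1`!%:R * m2`!%:R) :> R.
  rewrite -natrX -!natrM ler_nat (leq_trans (fact_split_le _ _))//.
  by rewrite leq_mul2r leq_pexp2l ?orbT.
have D0 := lt_le_trans a0 aD; have D10 := lt_le_trans a0 aD1.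
have D20 := lt_le_trans a0 aD2; have p0 := lt_le_trans ltr01 p_1.
have p10 := lt_le_trans ltr01 p11; have p20 := lt_le_trans ltr01 p21.
have bb0 : 0 < b ^+ 2 by rewrite exprn_gt0.
apply: (@le_trans _ _ ((m1 + m2)`!%:R / b ^+ 2)).
  rewrite mulrA ler_pM2r ?invr_gt0// -mulrA ler_piMr// mulrC ler_pdivrMr ?mulr_gt0//.
  by rewrite mul1r (le_trans aD)// ler_peMl// ltW.
apply: (@le_trans _ _ (2 ^+ n * (m1`!%:R * m2`!%:R) / b ^+ 2)).
  by rewrite ler_pM2r ?invr_gt0.
have -> : m1`!%:R / (p1 * D1) * (m2`!%:R / (p2 * D2)) * (2 ^+ n * n%:R ^+ (d.+2 + d.+2)) =
  2 ^+ n * (m1`!%:R * m2`!%:R) * ((N / p1 / D1) * (N / p2 / D2)).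
  rewrite exprD -/N; field.
  by rewrite !gt_eqF.
rewrite ler_wpM2l ?mulr_ge0 ?exprn_ge0 ?ler0n//.
have inv_le q E : 0 < q -> q <= N -> 0 < E -> E <= b -> b^-1 <= N / q / E.
  move=> q0 qN E0 Eb; apply: (@le_trans _ _ E^-1); first by rewrite lef_pV2.
  by rewrite ler_peMl ?invr_ge0 ?(ltW E0)// ler_pdivlMr ?mul1r.
rewrite expr2 invfM ler_pM ?invr_ge0 ?(ltW b0)// inv_le//.
Qed.

(** The hypothesis on [x1 - xb] provides a factor [expR (2 n)], up to the constant
    factor [expR (- b)] that bounds the influence of [T]; it beats the price
    [2 ^ n n ^ (2 d + 4)] of the cut because [2 <= expR 1]. *)
Lemma cluster_weight_split (M : R) :
  exists N : nat, forall n m1 m2 (x1 x2 xb : 'cV[R]_d),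
  (N <= n)%N -> (0 < m1)%N -> (0 < m2)%N -> (m1 + m2 <= n)%N ->
  (forall i, `|x1 i 0| <= M) -> (forall i, `|x2 i 0| <= M) ->
  (m1 + m2)%:R *: xb = m1%:R *: x1 + m2%:R *: x2 ->
  4 * n%:R <= m1%:R * bform (invmx Sigma) (x1 - xb) (x1 - xb) ->
  cluster_weight (m1 + m2) xb < cluster_weight m1 x1 * cluster_weight m2 x2.
Proof.
have [c [c0 coefP]] := cluster_coef_split.
pose b : R := M ^+ 2 * \sum_i \sum_j `|invmx T i j|.
have [N NP] := @expR_beats_exprn R (d.+2 + d.+2) ((C * c)^-1 * expR b).
exists N => n m1 m2 x1 x2 xb Nn m10 m20 m12n x1M x2M xbE gain.
have m0 : (0 < m1 + m2)%N by rewrite addn_gt0 m10.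
have exp_ge : 2 * n%:R - b + 2^-1 * cluster_exponent T Sigma (m1 + m2) xb <=
    2^-1 * cluster_exponent T Sigma m1 x1 + 2^-1 * cluster_exponent T Sigma m2 x2.
  have /andP[lo1 _] := cluster_exponent_bounds x1 pT pS m10.
  have /andP[lo2 _] := cluster_exponent_bounds x2 pT pS m20.
  have /andP[_ hi] := cluster_exponent_bounds xb pT pS m0.
  have b1 : bform (invmx T) x1 x1 <= b by exact: bform_le_bounded.
  have b2 : bform (invmx T) x2 x2 <= b by exact: bform_le_bounded.
  have pA := posdef_invmx pS; set A := invmx Sigma in lo1 lo2 hi gain pA *.
  have /(mulr_ge0 (ler0n R m2)) g2 := bform_ge0 (x2 - xb) pA.
  (* The variance decomposition of the two pieces around their common mean. *)
  have id : m1%:R * bform A (x1 - xb) (x1 - xb) + m2%:R * bform A (x2 - xb) (x2 - xb) =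
    m1%:R * bform A x1 x1 + m2%:R * bform A x2 x2 - (m1 + m2)%:R * bform A xb xb.
    have e1 : (m1 + m2)%:R * bform A xb xb = m1%:R * bform A x1 xb + m2%:R * bform A x2 xb.
      by rewrite -bformZl xbE bformDl !bformZl.
    rewrite !(bformDl, bformDr, bformNl, bformNr).
    rewrite (bform_sym xb x1 (proj1 pA)) (bform_sym xb x2 (proj1 pA)).
    move: e1; rewrite natrD; set u := bform A xb xb; set v := bform A x1 xb.
    set w := bform A x2 xb; set y := bform A x1 x1; set z := bform A x2 x2 => e1.
    lra.
  lra.
rewrite /cluster_weight.
set f1 := cluster_coef m1; set f2 := cluster_coef m2; set f := cluster_coef _.
have C0 := model_const_gt0.
have f0 : 0 < f by exact: cluster_coef_gt0.
have ff0 : 0 < f1 * f2 by rewrite mulr_gt0 ?cluster_coef_gt0.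
have := coefP _ _ _ m10 m20 m12n; rewrite -/f1 -/f2 -/f => ff.
set E := expR _; set E1 := expR _; set E2 := expR _.
have EE : expR (2 * n%:R - b) * E <= E1 * E2 by rewrite -!expRD ler_expR.
have E0 : 0 < E by exact: expR_gt0.
have -> : C * f1 * E1 * (C * f2 * E2) = C * (C * (f1 * f2) * (E1 * E2)) by ring.
rewrite -mulrA ltr_pM2l//.
apply: (@lt_le_trans _ _ (C * (f1 * f2) * (expR (2 * n%:R - b) * E))); last first.
  by rewrite ler_pM2l// mulr_gt0.
rewrite mulrA ltr_pM2r//.
have two_le : 2 ^+ n <= expR n%:R :> R.
  rewrite -[n%:R]mulr1 expRM_natl lerXn2r ?nnegrE ?expR_ge0//.
  by rewrite (le_trans _ (expR_ge1Dx 1)).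
have n0 : 0 < n%:R ^+ (d.+2 + d.+2) :> R.
  by rewrite exprn_gt0// ltr0n (leq_trans m0).
rewrite -(ltr_pM2r c0); apply: (le_lt_trans ff).
have -> : C * (f1 * f2) * expR (2 * n%:R - b) * c =
  f1 * f2 * (C * c * expR (- b) * expR n%:R * expR n%:R).
  by rewrite (_ : 2 * n%:R - b = - b + n%:R + n%:R) ?expRD; [ring|ring].
rewrite ltr_pM2l//.
apply: (@le_lt_trans _ _ (expR n%:R * n%:R ^+ (d.+2 + d.+2))).
  by rewrite ler_pM2r.
rewrite mulrC ltr_pM2r ?expR_gt0//.
have Cc0 : 0 < C * c by rewrite mulr_gt0.
have := NP n Nn; rewrite -[X in X < _]mulrA (ltr_pdivrMl _ _ Cc0) => h.
by rewrite expRN mulrAC ltr_pdivlMr ?expR_gt0// mulrC.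
Qed.

End SplitCluster.

(** * Choosing the cluster to cut *)

Section SplitPartition.
Variables (I : finType) (P : {set {set I}}) (D J U : {set I}).
Hypotheses (partP : finset.partition P D) (JP : J \in P).
Hypotheses (JU0 : J :&: U != finset.set0) (JD0 : J :\: U != finset.set0).

Definition split_partition : {set {set I}} :=
  (J :&: U |: (J :\: U |: (P :\ J)))%SET.

Let notin_partition (Q : {set {set I}}) (E B : {set I}) :
  finset.partition Q E -> B != finset.set0 ->
  fintype.disjoint (mem B) (mem E) -> B \notin Q.
Proof.
move=> partQ B0 BE; apply: contra B0 => BQ.
by rewrite -finset.subset0 -(finset.disjoint_setI0 BE) finset.subsetI subxx
  (partitionS partQ).
Qed.

Let partD1 := partitionD1 partP JP.

Let disjD : fintype.disjoint (mem (J :\: U)) (mem (D :\: J)).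
Proof.
rewrite -finset.setI_eq0; apply/eqP/finset.setP => i; rewrite !inE.
by case: (i \in J); rewrite ?andbF.
Qed.

Let disjI :
  fintype.disjoint (mem (J :&: U)) (mem ((J :\: U) :|: (D :\: J))).
Proof.
rewrite -finset.setI_eq0; apply/eqP/finset.setP => i; rewrite !inE.
by case: (i \in J); case: (i \in U); rewrite ?andbF.
Qed.

Let partD2 := partitionU1 partD1 JD0 disjD.

Lemma split_partitionP : finset.partition split_partition D.
Proof.
have <- : (J :&: U :|: (J :\: U :|: (D :\: J)) = D)%SET.
  rewrite finset.setUA finset.setID; apply/finset.setP => i; rewrite !inE.
  by have /fintype.subsetP/(_ i) := partitionS partP JP; case: (i \in J) => // ->.
exact: partitionU1.
Qed.

Lemma prod_split_partition (R : comPzRingType) (F : {set I} -> R) :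
  \prod_(B in split_partition) F B =
  F (J :&: U) * F (J :\: U) * \prod_(B in P :\ J) F B.
Proof.
rewrite big_setU1; last exact: notin_partition partD2 JU0 disjI.
rewrite big_setU1; last exact: notin_partition partD1 JD0 disjD.
exact: mulrA.
Qed.

End SplitPartition.

Section ClusterMean.
Variables (R : realType) (d n : nat) (x : 'I_n -> 'cV[R]_d).
Implicit Types (A J U : {set 'I_n}).

Lemma cluster_mean_close A (k : 'I_d) (y r : R) : A != finset.set0 ->
  (forall i, i \in A -> `|x i k 0 - y| <= r) -> `|cluster_mean x A k 0 - y| <= r.
Proof.
move=> A0 xyr; have cA : 0 < #|A|%:R :> R by rewrite ltr0n card_gt0.
rewrite -(ler_pM2l cA) -{1}(gtr0_norm cA) -normrM mulrBr.
rewrite !mxE mulVKf ?gt_eqF// summxE mulr_natl -sumr_const -sumrB.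
by rewrite (le_trans (ler_norm_sum _ _ _))// mulr_natl -sumr_const ler_sum.
Qed.

Lemma cluster_mean_split J U :
  J :&: U != finset.set0 -> J :\: U != finset.set0 ->
  (#|J :&: U| + #|J :\: U|)%:R *: cluster_mean x J =
  #|J :&: U|%:R *: cluster_mean x (J :&: U) +
  #|J :\: U|%:R *: cluster_mean x (J :\: U).
Proof.
have meanE A : A != finset.set0 -> #|A|%:R *: cluster_mean x A = \sum_(j in A) x j.
  by move=> A0; rewrite scalerA divff ?scale1r// pnatr_eq0 cards_eq0.
move=> JU JD; rewrite cardsID !meanE//; last first.
  by apply: contra JU => /eqP->; rewrite finset.set0I.
by rewrite (big_setID U).
Qed.

End ClusterMean.

(** Values of [s] are so far apart that each [f J] is within [2 h] of at most one
    of them, and there are fewer values [f J] than elements of [s]. *)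
Lemma far_from_centers (R : realType) (I : finType) (P : {set I}) (f : I -> R)
    (s : seq R) (h : R) : uniq s -> (#|P| < size s)%N ->
  (forall y z, y \in s -> z \in s -> y != z -> 4 * h <= `|y - z|) ->
  exists2 y, y \in s & forall J, J \in P -> 2 * h <= `|f J - y|.
Proof.
move=> us Ps sep; apply: contrapT => no.
have near y : y \in s -> exists J, (J \in P) && (`|f J - y| < 2 * h).
  move=> ys; apply: contrapT => noJ; apply: no; exists y => // J JP.
  by rewrite leNgt; apply/negP => lt; apply: noJ; exists J; rewrite JP.
pose g J := [seq y <- s | `|f J - y| < 2 * h].
have gE J y : y \in s -> `|f J - y| < 2 * h -> head 0 (g J) = y.
  move=> ys fy; have : head 0 (g J) \in g J.
    have : y \in g J by rewrite mem_filter fy.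
    by case: (g J) => // z t _; rewrite mem_head.
  rewrite mem_filter => /andP[fz zs]; apply/eqP; apply: contraT => zy.
  have := sep _ _ zs ys zy; rewrite leNgt => /negP[].
  rewrite (le_lt_trans (ler_distD (f J) _ _))// (distrC _ (f J)).
  by rewrite (_ : 4 * h = 2 * h + 2 * h) ?ltrD//; ring.
have : (size s <= size [seq head 0%R (g J) | J <- enum P])%N.
  apply: uniq_leq_size => // y ys; have [J /andP[JP Jy]] := near y ys.
  by apply/mapP; exists J; rewrite ?mem_enum// (gE J y).
by rewrite size_map -cardE leqNgt Ps.
Qed.

Section ManyClusters.
Variables (R : realType) (d : nat) (alpha : R) (T Sigma : 'M[R]_d).
Hypotheses (alpha0 : 0 < alpha) (pT : posdefmx T) (pS : posdefmx Sigma).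

Lemma is_MAP_split n (x : 'I_n -> 'cV[R]_d) P J U :
  is_MAP alpha T Sigma x P -> J \in P ->
  J :&: U != finset.set0 -> J :\: U != finset.set0 ->
  cluster_weight alpha T Sigma #|J :&: U| (cluster_mean x (J :&: U)) *
  cluster_weight alpha T Sigma #|J :\: U| (cluster_mean x (J :\: U)) <=
  cluster_weight alpha T Sigma #|J| (cluster_mean x J).
Proof.
move=> [partP maxP] JP JU JD.
have := maxP _ (split_partitionP partP JP JU JD).
rewrite !posteriorQE (prod_split_partition partP)// [X in _ <= X -> _](big_setD1 J)//=.
rewrite ler_pM2r// prodr_gt0// => A; rewrite !inE => /andP[_ AP].
by apply: cluster_weight_gt0 => //; rewrite card_gt0 (partition_neq0 partP).
Qed.

(** The bound on [opnorm Sigma] is the one for which a piece of [c n / (K + 1)]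
    points whose mean moves by [h] produces the gain [4 n] required by
    [cluster_weight_split]. *)
Lemma MAP_many_clusters (K : nat) (k : 'I_d) (s : seq R) (h c M : R) :
  0 < h -> 0 < c -> uniq s -> size s = K.+1 ->
  (forall y z, y \in s -> z \in s -> y != z -> 4 * h <= `|y - z|) ->
  opnorm Sigma < c * h ^+ 2 / (4 * K.+1%:R) ->
  exists N : nat, forall n (x : 'I_n -> 'cV[R]_d), (N <= n)%N ->
    (forall i j, `|x i j 0| <= M) ->
    (forall y, y \in s -> c * n%:R <= #|[set i | `|x i k 0 - y| < h]%SET|%:R) ->
    forall P, is_MAP alpha T Sigma x P -> (K < #|P|)%N.
Proof.
move=> h0 c0 us sK sep Seps.
have [N NP] := cluster_weight_split alpha0 pT pS M.
exists N.+1 => n x Nn xM xs P MAP; rewrite ltnNge; apply/negP => PK.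
have n0 : 0 < n%:R :> R by rewrite ltr0n (leq_trans _ Nn).
have Ps : (#|P| < size s)%N by rewrite sK ltnS.
have [y ys far] := far_from_centers (fun J => cluster_mean x J k 0) us Ps sep.
set U := [set i | `|x i k 0 - y| < h]%SET in xs *.
have [partP _] := MAP.
(* Pigeonhole: the points near [y] are shared by at most [K] clusters. *)
have [J JP JU] : exists2 J, J \in P & c * n%:R <= #|J :&: U|%:R * K.+1%:R.
  apply: contrapT => noJ.
  have UE : #|U|%:R = \sum_(J in P) #|J :&: U|%:R :> R.
    rewrite -natr_sum; congr _%:R.
    rewrite -sum1_card (eq_bigl (fun i => (i \in [set: 'I_n]%SET) && (i \in U))); last first.
      by move=> i; rewrite finset.in_setT.
    rewrite (set_partition_big_cond _ partP); apply: eq_bigr => J _.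
    by rewrite -sum1_card; apply: eq_bigl => i; rewrite finset.in_setI.
  have : #|U|%:R * K.+1%:R <= #|P|%:R * (c * n%:R).
    rewrite UE mulr_suml mulr_natl -sumr_const ler_sum// => J JP.
    by rewrite leNgt; apply/negP => /ltW lt; apply: noJ; exists J.
  have : c * n%:R * K.+1%:R <= #|U|%:R * K.+1%:R by rewrite ler_pM2r ?ltr0n// xs.
  move=> /le_trans h1 /h1; rewrite mulrC ler_pM2r ?mulr_gt0//.
  by rewrite ler_nat leqNgt ltnS PK.
have JU0 : J :&: U != finset.set0.
  apply: contraTneq JU => ->; rewrite cards0 mul0r -ltNge mulr_gt0//.
have close : `|cluster_mean x (J :&: U) k 0 - y| <= h.
  by apply: cluster_mean_close => // i; rewrite !inE => /andP[_ /ltW].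
(* A cluster contained in the slab would have its mean within [h] of [y]. *)
have JD0 : J :\: U != finset.set0.
  apply/negP => /eqP JD; move: close (far J JP).
  rewrite (_ : J :&: U = J); last by rewrite -[RHS](finset.setID J U) JD finset.setU0.
  by move=> /[swap] /le_trans/[apply]; lra.
have mean_le (A : {set 'I_n}) j : A != finset.set0 -> `|cluster_mean x A j 0| <= M.
  by move=> A0; rewrite -[_ j 0]subr0 cluster_mean_close// => i _; rewrite subr0.
have := is_MAP_split MAP JP JU0 JD0; apply/negP; rewrite -ltNge.
rewrite -[X in cluster_weight _ _ _ X _ < _](cardsID U J).
apply: (NP n); rewrite ?card_gt0//.
- exact: ltnW.
- by rewrite cardsID -[X in (_ <= X)%N]card_ord max_card.
- by move=> i; exact: mean_le.
- by move=> i; exact: mean_le.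
- exact: cluster_mean_split.
set v := cluster_mean x (J :&: U) - cluster_mean x J.
have vh : h ^+ 2 <= v k 0 ^+ 2.
  rewrite -[leRHS]real_normK ?num_real// lerXn2r ?nnegrE ?(ltW h0)//.
  have -> : v k 0 = cluster_mean x (J :&: U) k 0 - cluster_mean x J k 0.
    by rewrite mxE [X in _ + X]mxE.
  move: (far J JP) close; set a := cluster_mean _ _ _ _; set b := cluster_mean _ _ _ _.
  by have := ler_distD b a y; rewrite (distrC a b); lra.
have q0 := bform_ge0 v (posdef_invmx pS).
set q := bform _ v v in q0 *.
have h2 : h ^+ 2 <= c * h ^+ 2 / (4 * K.+1%:R) * q.
  apply: (le_trans vh); apply: (le_trans (coord_sqr_le_bform_invmx v k pS)).
  by rewrite ler_wpM2r// (le_trans (opnorm_ge_diag _ k))// ltW.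
have K0 : 0 < 4 * K.+1%:R :> R by rewrite mulr_gt0// ltr0n.
have q4 : 4 * K.+1%:R <= c * q.
  move: h2; rewrite (_ : _ * q = h ^+ 2 * (c * q / (4 * K.+1%:R))); last by ring.
  by rewrite ler_pMr ?exprn_gt0// ler_pdivlMr// mul1r.
have K10 : 0 < K.+1%:R :> R by rewrite ltr0n.
rewrite -(ler_pM2r K10); apply: (@le_trans _ _ (c * n%:R * q)).
  by rewrite mulrAC [leRHS]mulrAC ler_wpM2r// ltW.
by rewrite [leRHS]mulrAC ler_wpM2r.
Qed.

End ManyClusters.

(** * Frequency of visits to a set of positive probability *)

Section PositiveFrequency.
Variables (R : realType) (dO : measure_display) (Omega : measurableType dO).
Variables (dS : measure_display) (S : measurableType dS).
Variables (Pr : probability Omega R) (P : probability S R).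
Variable X : nat -> {RV Pr >-> S}.
Hypothesis iidX : iid P X.

(** The indices are grouped into consecutive blocks of length [L]; [bs] lists the
    numbers of the selected blocks. *)
Definition block_indices (L : nat) (bs : seq nat) : seq nat :=
  [seq (b * L + j)%N | b <- bs, j <- iota 0 L].

Lemma block_indices_uniq L bs : uniq bs -> uniq (block_indices L bs).
Proof.
move=> ubs; apply: allpairs_uniq => //; first exact: iota_uniq.
move=> [b1 j1] [b2 j2] /allpairsP[[c1 i1] /= [_ ]].
rewrite mem_iota add0n => /= i1L [-> ->].
move=> /allpairsP[[c2 i2] /= [_ ]]; rewrite mem_iota add0n => /= i2L [-> ->] E.
have L0 : (0 < L)%N by rewrite (leq_trans _ i1L).
have Ed : c1 = c2.
  by move: (congr1 (divn^~ L) E); rewrite !divnMDl// !divn_small// !addn0.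
by move: E; rewrite Ed => /addnI ->.
Qed.

Lemma block_indicesP L bs i : (0 < L)%N ->
  (i \in block_indices L bs) = ((i %/ L)%N \in bs).
Proof.
move=> L0; apply/allpairsP/idP => [[[b j] /= [bbs]]|ibs].
  by rewrite mem_iota add0n => /= jL ->; rewrite divnMDl// divn_small// addn0.
exists ((i %/ L)%N, (i %% L)%N); split => //=; last exact: divn_eq.
by rewrite mem_iota add0n ltn_pmod.
Qed.

Definition blocks_inside (V : set S) (L : nat) (bs : seq nat) : set Omega :=
  \bigcap_(i in [set` block_indices L bs]) (X i @^-1` V).

Lemma blocks_inside_measurable V L bs : measurable V ->
  measurable (blocks_inside V L bs).
Proof.
move=> mV; apply: fin_bigcap_measurable => [|i _]; first exact: finite_seq.
by rewrite -[X in measurable X]setTI; exact: measurable_funPT.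
Qed.

Lemma blocks_inside_prob V (q : R) L bs : measurable V -> P V = q%:E -> uniq bs ->
  Pr (blocks_inside V L bs) = ((q ^+ L) ^+ size bs)%:E.
Proof.
move=> mV PV ubs; have [indep idist] := iidX.
rewrite /blocks_inside (indep _ (fun=> V))//; last exact: block_indices_uniq.
have PX i : Pr (X i @^-1` V) = q%:E by rewrite -PV -(idist i V mV).
under eq_bigr do rewrite PX.
rewrite prodEFin big_const_seq count_predT iter_mulr_1.
by rewrite size_allpairs size_iota mulnC exprM.
Qed.

Lemma measure_bigsetU_le (I : Type) (r : seq I) (F : I -> set Omega) :
  (forall i, measurable (F i)) ->
  (Pr (\big[setU/set0]_(i <- r) F i) <= \sum_(i <- r) Pr (F i))%E.
Proof.
move=> mF; elim: r => [|i r IH]; first by rewrite !big_nil measure0.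
rewrite !big_cons (le_trans (measureU2 _ (mF i) _))//.
  by apply: bigsetU_measurable => j _; exact: mF.
by rewrite leeD2l.
Qed.

Definition half_blocks_inside (V : set S) (L k : nat) : set Omega :=
  \big[setU/set0]_(B : {set 'I_k} | (k <= #|B|.*2)%N)
    blocks_inside V L [seq val b | b <- enum B].

Lemma half_blocks_inside_measurable V L k : measurable V ->
  measurable (half_blocks_inside V L k).
Proof.
by move=> mV; apply: bigsetU_measurable => B _; exact: blocks_inside_measurable.
Qed.

(** A union bound over the at most [2 ^ k] sets [B] of blocks.  Each has
    probability at most [16^-1 ^+ #|B| <= 4^-1 ^+ k], which leaves [2^-1 ^+ k];
    the right-hand side is this number in the form of a summable geometric term. *)
Lemma half_blocks_inside_prob V (q : R) L k : measurable V -> P V = q%:E ->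
  0 <= q -> q ^+ L <= 16^-1 ->
  (Pr (half_blocks_inside V L k) <= (2 / (2 ^ (k + 1))%:R)%:E)%E.
Proof.
move=> mV PV q0 qL; rewrite /half_blocks_inside -big_filter.
apply: (le_trans (measure_bigsetU_le _ _)).
  by move=> B; exact: blocks_inside_measurable.
rewrite big_filter.
apply: (@le_trans _ _ (\sum_(B : {set 'I_k}) ((4^-1 : R) ^+ k)%:E)%E).
  rewrite [leLHS]big_mkcond /=; apply: lee_sum => B _.
  case: ifPn => [kB|_]; last by rewrite lee_fin exprn_ge0.
  rewrite (blocks_inside_prob _ mV PV); last first.
    by rewrite map_inj_uniq ?enum_uniq//; exact: val_inj.
  rewrite size_map -cardE lee_fin.
  apply: (@le_trans _ _ ((16^-1) ^+ #|B|)).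
    by rewrite lerXn2r ?nnegrE ?exprn_ge0.
  rewrite (_ : 16^-1 = 4^-1 ^+ 2 :> R); last by rewrite exprVn -natrX.
  rewrite -exprM mul2n ler_wiXn2l//.
  by rewrite invf_le1// ler1n.
rewrite sumEFin lee_fin sumr_const -cardsT -powersetT card_powerset.
rewrite cardsT card_ord -[leLHS]mulr_natl.
rewrite addn1 expnS natrM [X in _ <= 2 * X]invfM mulrA divff// mul1r.
rewrite natrX -exprMn -exprVn.
by rewrite (_ : 2 * 4^-1 = 2^-1 :> R)//; field.
Qed.

(** Borel-Cantelli: the probabilities bounded above are summable. *)
Lemma half_blocks_inside_ae V (q : R) L : measurable V -> P V = q%:E ->
  0 <= q -> q ^+ L <= 16^-1 ->
  {ae Pr, forall w, \forall k \near \oo, ~ half_blocks_inside V L k w}.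
Proof.
move=> mV PV q0 qL.
have mF k : measurable (half_blocks_inside V L k) by exact: half_blocks_inside_measurable.
have F0 : Pr (lim_sup_set (half_blocks_inside V L)) = 0%E.
  apply: lim_sup_set_cvg0 => //.
  apply: (@le_lt_trans _ _ (\sum_(k <oo) (2 / (2 ^ (k + 1))%:R)%:E)%E).
    by apply: lee_nneseries => k _ //; exact: half_blocks_inside_prob PV q0 qL.
  have /cvg_lim -> // := @cvg_geometric_eseries_half R 2 0.
  by rewrite ltry.
exists (lim_sup_set (half_blocks_inside V L)); split => //.
  by apply: bigcapT_measurable => n; apply: bigcup_measurable.
move=> w /= notnear n _ /=; apply: contrapT => no; apply: notnear.
by exists n => // k /= nk Fk; apply: no; exists k.
Qed.

(** A single index misses [p] with some probability [q < 1], hence a block of [L]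
    indices with probability [q ^+ L], at most [1 / 16] for [L] large.  Almost surely
    at least half of the first [k] blocks then meet [p] once [k] is large, so that
    [p] is visited at least once in every [2 L] indices on average.  Working with
    blocks replaces the law of large numbers by a union bound that uses
    independence only through the probabilities of finite intersections. *)
Lemma positive_frequency (p : pred S) : measurable [set v | p v] ->
  (0 < P [set v | p v])%E ->
  exists c : R, 0 < c /\ {ae Pr, forall w, \forall n \near \oo,
    c * n%:R <= #|[set i : 'I_n | p (X i w)]%SET|%:R}.
Proof.
move=> mU U0; set U := [set v | p v] in mU U0.
have mV : measurable (~` U) by exact: measurableC.
pose q := fine (P (~` U)).
have PV : P (~` U) = q%:E by rewrite fineK ?fin_num_measure.
have q0 : 0 <= q by rewrite fine_ge0.
have q1 : q < 1.
  rewrite -lte_fin -PV probability_setC//.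
  have : P U \is a fin_num by exact: fin_num_measure.
  by move: U0; case: (P U) => // r; rewrite -EFinB !lte_fin => r0 _; rewrite ltrBlDr ltrDl.
have [L [L0 qL]] : exists L, (0 < L)%N /\ q ^+ L <= 16^-1.
  have /cvg_expr/cvgrPdist_le : `|q| < 1 by rewrite ger0_norm.
  move=> /(_ (16^-1)); rewrite invr_gt0 ltr0n => /(_ isT)[L _ LP].
  exists L.+1; split => //; have := LP L.+1 (leqnSn L).
  by rewrite sub0r normrN ger0_norm// exprn_ge0.
(* With [k = n %/ L] blocks inside the first [n] indices there are at least
   [k / 2 >= n / (4 L)] visits; [k >= 1] absorbs the incomplete block. *)
exists (4 * L%:R)^-1; split; first by rewrite invr_gt0 mulr_gt0// ltr0n.
have := half_blocks_inside_ae mV PV q0 qL; apply: filterS => w [k0 _ noinside].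
exists ((maxn k0 1) * L)%N => // n /= k0n.
pose k := (n %/ L)%N.
have k0k : (k0 <= k)%N by rewrite leq_divRL// (leq_trans _ k0n)// leq_mul2r leq_maxl orbT.
have k1 : (0 < k)%N by rewrite leq_divRL// (leq_trans _ k0n)// leq_mul2r leq_maxr orbT.
pose A := [set i : 'I_n | p (X i w)]%SET.
(* The blocks, among the first [k], that miss [p]. *)
pose B := [set b : 'I_k | [forall i : 'I_n, ((i %/ L)%N == b) ==> ~~ p (X i w)]]%SET.
have kL : (k * L <= n)%N by rewrite leq_trunc_div.
have Bk : (#|B|.*2 < k)%N.
  rewrite ltnNge; apply/negP => kB; apply: (noinside k k0k).
  rewrite /half_blocks_inside (bigD1 B)//=; left => i /=.
  rewrite block_indicesP// => /mapP[b]; rewrite mem_enum inE => /forallP bB ib.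
  have iL : (i < n)%N.
    rewrite (leq_trans _ kL)// -ltn_divLR// ib; exact: ltn_ord.
  have := bB (Ordinal iL); rewrite /= ib eqxx /= => /negP npX.
  exact: npX.
have BA : (#|(~: B)%SET| <= #|A|)%N.
  rewrite !cardE -(size_map val) -(size_map (fun i : 'I_n => (i %/ L)%N)).
  apply: uniq_leq_size; first by rewrite map_inj_uniq ?enum_uniq//; exact: val_inj.
  move=> _ /mapP[b + ->]; rewrite mem_enum finset.in_setC => bB.
  have [i /andP[/eqP ib pX]] : exists i : 'I_n, ((i %/ L)%N == b) && p (X i w).
    apply: contrapT => no; move: bB; rewrite inE => /negP; apply.
    apply/forallP => i; apply/implyP => ib; apply/negP => pX.
    by apply: no; exists i; rewrite ib.
  apply/mapP; exists i => //.
  by rewrite mem_enum inE.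
have cA : (k <= #|A|.*2)%N.
  have := cardsC B; rewrite card_ord => BC.
  by move: Bk BA BC; rewrite -!mul2n; lia.
have nA : (n <= 4 * L * #|A|)%N.
  have : (n < k.+1 * L)%N by rewrite -ltn_divLR.
  by move: cA k1; rewrite -mul2n; nia.
rewrite mulrC ler_pdivrMr ?mulr_gt0 ?ltr0n// mulrC.
by rewrite -!natrM ler_nat.
Qed.

End PositiveFrequency.

(** * The support of an absolutely continuous distribution *)

Section Support.
Variables (R : realType) (d : nat) (P : probability (borel_cV R d) R).

Lemma open_measurable_cV (U : set 'cV[R]_d) : open U ->
  measurable (U : set (borel_cV R d)).
Proof. exact: sub_sigma_algebra. Qed.

(** Boxes with rational corners form a countable base of open sets. *)
Definition rat_box (q : 'cV[rat]_d * 'cV[rat]_d) : set (borel_cV R d) :=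
  [set v | forall i, ratr (q.1 i 0) < v i 0 < ratr (q.2 i 0)].

Lemma rat_box_measurable q : measurable (rat_box q).
Proof.
have -> : rat_box q = \bigcap_(i in [set: 'I_d])
    ((fun v : borel_cV R d => v i 0 : measurableTypeR R) @^-1`
      `]ratr (q.1 i 0), ratr (q.2 i 0)[%classic).
  apply/seteqP; split => v /=.
    by move=> h i _ /=; rewrite in_itv; exact: h.
  by move=> h i; have := h i I; rewrite /= in_itv.
apply: fin_bigcap_measurable => // i _.
by rewrite -[X in measurable X]setTI; apply: measurable_cV_coord => //; exact: measurable_itv.
Qed.

Lemma rat_box_basis (U : set 'cV[R]_d) v : open U -> U v ->
  exists q, rat_box q v /\ rat_box q `<=` U.
Proof.
move=> oU Uv.
have /nbhs_ballP[e /= e0 eU] : nbhs v U by exact: open_nbhs_nbhs.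
have near_rat (a b : R) : a < b -> exists q : rat, a < ratr q < b.
  by move=> /rat_in_itvoo[q]; rewrite in_itv /= => ?; exists q.
have /choice[a aP] i : exists q : rat, v i 0 - e < ratr q < v i 0.
  by apply: near_rat; rewrite ltrBlDr ltrDl.
have /choice[b bP] i : exists q : rat, v i 0 < ratr q < v i 0 + e.
  by apply: near_rat; rewrite ltrDl.
exists (\col_i a i, \col_i b i); split=> [i|w /= bw].
  by rewrite !mxE; case/andP: (aP i) (bP i) => _ -> /andP[->].
apply: eU; split => // i j; rewrite (ord1 j).
have := bw i; rewrite !mxE /= => /andP[aw wb].
have /andP[va _] := aP i; have /andP[_ bv] := bP i.
rewrite /ball /= ltr_norml; apply/andP; split.
  by rewrite ltrBrDl -ltrBrDr opprK; exact: lt_trans wb bv.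
by rewrite ltrBlDl -ltrBlDr; exact: lt_trans va aw.
Qed.

(** The complement is a union of null open sets, hence of countably many null
    boxes with rational corners. *)
Lemma msupport_full : P.-negligible (~` msupport P).
Proof.
pose null (q : 'cV[rat]_d * 'cV[rat]_d) :=
  if `[< P (rat_box q) = 0%E >] then rat_box q else set0.
apply: (@negligibleS _ _ _ _ (\bigcup_n
  (if unpickle n is Some q then null q else set0))).
  move=> v /= /existsNP[U /not_implyP[oU /not_implyP[Uv /negP PU]]].
  have [q [qv qU]] := rat_box_basis oU Uv.
  exists (pickle q) => //; rewrite pickleK /null.
  suff -> : P (rat_box q) = 0%E by rewrite asboolT.
  apply/eqP; rewrite -measure_le0; apply: contraNT PU => /negP Pq.
  rewrite lt_neqAle measure_ge0 andbT eq_sym.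
  apply/eqP => PU0; apply: Pq; rewrite -PU0 le_measure ?inE//.
    exact: rat_box_measurable.
  exact: open_measurable_cV.
apply: negligible_bigcup => n; case: unpickle => [q|]; last exact: negligible_set0.
rewrite /null; case: asboolP => [q0|_]; last exact: negligible_set0.
by apply/negligibleP => //; exact: rat_box_measurable.
Qed.

Hypothesis Pac : P `<< lebesgue_cV R d.

(** A hyperplane is a box with one side reduced to a point, so that its Lebesgue
    measure is a product with a factor 0. *)
Lemma coord_fiber_null (k : 'I_d) (c : R) : P.-negligible [set v | v k 0 = c].
Proof.
pose A i : set (measurableTypeR R) := if i == k then [set c] else setT.
have mA i : measurable (A i) by rewrite /A; case: ifP.
have HE : [set v : borel_cV R d | v k 0 = c] = [set v | forall i, A i (v i 0)].
  apply/seteqP; split => v /= h; last by have := h k; rewrite /A eqxx.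
  by move=> i; rewrite /A; case: eqP => // ->.
have mH : measurable [set v : borel_cV R d | v k 0 = c].
  have -> : [set v : borel_cV R d | v k 0 = c] =
      (fun v : borel_cV R d => v k 0 : measurableTypeR R) @^-1` [set c] by [].
  by rewrite -[X in measurable X]setTI; apply: measurable_cV_coord.
have lebH : lebesgue_cV R d [set v : borel_cV R d | v k 0 = c] = 0%E.
  rewrite HE lebesgue_cV_box// (bigD1 k)//= /A eqxx lebesgue_measure_set1.
  by rewrite mul0e.
apply/negligibleP => //; apply: (Pac _ mH (@subset_refl _ _)).
exact/negligible_null_set/negligibleP.
Qed.

(** Otherwise the support would be covered by finitely many hyperplanes, which are
    null sets. *)
Lemma msupport_coords (k : 'I_d) m : exists s : seq R,
  [/\ uniq s, size s = m & forall y, y \in s -> exists2 v, msupport P v & v k 0 = y].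
Proof.
elim: m => [|m [s [us sm sP]]]; first by exists [::].
suff [v Pv vs] : exists2 v, msupport P v & v k 0 \notin s.
  exists (v k 0 :: s); split; rewrite /= ?vs ?sm// => y.
  by rewrite inE => /predU1P[->|/sP//]; exists v.
apply: contrapT => no.
have : P.-negligible [set: borel_cV R d].
  apply: (@negligibleS _ _ _ P ((~` msupport P : set (borel_cV R d)) `|`
      \bigcup_n (if (n < size s)%N then [set v : borel_cV R d | v k 0 = s`_n] else set0))).
    move=> v _; have [Pv|nPv] := pselect (msupport P v); [right|by left].
    have vs : v k 0 \in s by apply: contrapT => /negP vs; apply: no; exists v.
    by exists (index (v k 0) s) => //; rewrite index_mem vs /= nth_index.
  apply: negligibleU; first exact: msupport_full.
  apply: negligible_bigcup => n; case: ifP => _; last exact: negligible_set0.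
  exact: coord_fiber_null.
move=> /(negligibleP _ (@measurableT _ (borel_cV R d))) PT0.
have := @probability_setT _ _ _ P; rewrite PT0 => /eqP.
by rewrite eq_sym onee_eq0.
Qed.

End Support.

(** * The theorem *)

Lemma uniform_positive_bound (R : realType) (I : eqType) (s : seq I)
    (Q : I -> R -> Prop) :
  (forall i c c', 0 < c' -> c' <= c -> Q i c -> Q i c') ->
  (forall i, i \in s -> exists c, 0 < c /\ Q i c) ->
  exists c, 0 < c /\ forall i, i \in s -> Q i c.
Proof.
move=> Qle; elim: s => [_|i s IH Qs]; first by exists 1.
have [j js|c [c0 cP]] := IH; first by apply: Qs; rewrite inE js orbT.
have [c' [c'0 c'P]] := Qs i (mem_head _ _).
have m0 : 0 < Num.min c c' by rewrite lt_min c0.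
exists (Num.min c c'); split => // j; rewrite inE => /predU1P[->|js].
  by apply: Qle c'P => //; rewrite ge_min lexx orbT.
by apply: Qle (cP j js) => //; rewrite ge_min lexx.
Qed.

Lemma filter_forall_seq (T : Type) (I : eqType) (F : set_system T) (s : seq I)
    (Q : I -> T -> Prop) : Filter F ->
  (forall i, i \in s -> F [set t | Q i t]) ->
  F [set t | forall i, i \in s -> Q i t].
Proof.
move=> FF; elim: s => [_|i s IH Qs].
  by apply: filterS filterT => t _ i; rewrite in_nil.
apply: filterS2 (Qs i (mem_head _ _)) (IH _) => [t Qi Qst j|j js].
  by rewrite inE => /predU1P[->//|]; exact: Qst.
by apply: Qs; rewrite inE js orbT.
Qed.

Lemma separation_constant (R : realType) (s : seq R) :
  exists h, 0 < h /\ forall y z, y \in s -> z \in s -> y != z -> 4 * h <= `|y - z|.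
Proof.
pose Q (p : R * R) h := p.1 != p.2 -> 4 * h <= `|p.1 - p.2|.
have [[y z] c c' c'0 c'c Qc /Qc|[y z] _|h [h0 hP]] :=
    @uniform_positive_bound R _ [seq (y, z) | y <- s, z <- s] Q.
- by apply: le_trans; rewrite ler_pM2l.
- have [yz|yz] := eqVneq y z; first by exists 1; split=> //; rewrite /Q /= yz eqxx.
  exists (`|y - z| / 4); split; first by rewrite divr_gt0// normr_gt0 subr_eq0.
  by move=> _ /=; rewrite mulrC divfK.
exists h; split=> // y z ys zs; apply: (hP (y, z)).
by apply/allpairsP; exists (y, z).
Qed.

Lemma slab_open (R : realType) d (k : 'I_d) (y h : R) :
  open [set v : 'cV[R]_d | `|v k 0 - y| < h].
Proof.
have -> : [set v : 'cV[R]_d | `|v k 0 - y| < h] =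
    (fun v : 'cV[R]_d => v k 0) @^-1` `]y - h, y + h[%classic.
  by apply/seteqP; split=> v /=; rewrite in_itv/= ltr_distl.
by have /continuousP := @coord_continuous R d 1 k 0; apply; exact: interval_open.
Qed.

Theorem proposition4 (R : realType) (d : nat) (alpha : R) (T : 'M[R]_d)
    (hd : (1 <= d)%N) (halpha : 0 < alpha) (hT : posdefmx T)
    (P : probability (borel_cV R d) R)
    (hbounded : bounded_set (msupport P))
    (habscont : P `<< lebesgue_cV R d)
    (dO : measure_display) (Omega : measurableType dO)
    (Pr : probability Omega R) (X : nat -> {RV Pr >-> borel_cV R d})
    (hX : iid P X) (K : nat) :
  exists eps : R, 0 < eps /\
    forall Sigma : 'M[R]_d, posdefmx Sigma -> opnorm Sigma < eps ->
      {ae Pr, forall w, \forall n \near \oo,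
        forall J : {set {set 'I_n}},
          is_MAP alpha T Sigma (fun i : 'I_n => (X i w : 'cV[R]_d)) J ->
          (K < #|J|)%N}.
Proof.
pose k : 'I_d := Ordinal hd.
have [s [us sK sP]] := msupport_coords habscont k K.+1.
have [h [h0 sep]] := separation_constant s.
have X_support : {ae Pr, forall w, forall i, msupport P (X i w)}.
  apply: ae_foralln => i; have [N [mN N0 sub]] := msupport_full P.
  exists (X i @^-1` N); split.
  - by rewrite -[X in measurable X]setTI; exact: measurable_funPT.
  - by rewrite -N0 -(proj2 hX i N mN).
  - by move=> w /= /sub.
pose slab y : pred (borel_cV R d) := fun v => `|v k 0 - y| < h.
pose frequent (y c : R) := {ae Pr, forall w, \forall n \near \oo,
  c * n%:R <= #|[set i : 'I_n | slab y (X i w)]%SET|%:R}.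
have [y c c' c'0 c'c|y ys|c [c0 cP]] := @uniform_positive_bound R _ s frequent.
- apply: filterS => w; apply: filterS => n; apply: le_trans.
  by rewrite ler_wpM2r.
- have [v Pv vy] := sP y ys.
  apply: (positive_frequency hX (p := slab y)).
    by apply: open_measurable_cV; exact: slab_open.
  by apply: Pv; [exact: slab_open|rewrite /= /slab vy subrr normr0].
have {}cP : {ae Pr, forall w, \forall n \near \oo, forall y, y \in s ->
    c * n%:R <= #|[set i : 'I_n | slab y (X i w)]%SET|%:R}.
  apply: filterS (filter_forall_seq (Q := fun y w => \forall n \near \oo,
    c * n%:R <= #|[set i : 'I_n | slab y (X i w)]%SET|%:R) _ cP) => w cPw.
  exact: (filter_forall_seq (F := \oo)).
(* [bounded_set] provides the bounds above [M], not [M] itself. *)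
have [M [_ MP]] := hbounded.
have bdd v i : msupport P v -> `|v i 0| <= M + 1.
  move=> /(MP (M + 1)); rewrite ltrDl => /(_ ltr01); apply: le_trans.
  rewrite [leRHS]mx_normrE; exact: (le_bigmax _ (fun ij => `|v ij.1 ij.2|) (i, 0)).
exists (c * h ^+ 2 / (4 * K.+1%:R)); split.
  by rewrite divr_gt0 ?mulr_gt0 ?exprn_gt0 ?ltr0n.
move=> Sigma pS Seps.
have [N NP] := MAP_many_clusters halpha hT pS k (M + 1) h0 c0 us sK sep Seps.
apply: filterS2 X_support cP => w Xw cPw.
near=> n => J; apply: NP.
- by near: n; exists N.
- by move=> i j; apply: bdd; exact: Xw.
- by near: n.
Unshelve. all: by end_near.
Qed.
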